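(* Let $\{P_n(z)\}_{n=0}^\infty$ be a monic OPS with respect to a positive-definite linear functional $\mathcal{L}$, let $\kappa\in\mathbb{C}\setminus\mathbb{R}$, and let $\{P_n^{-*}(\kappa,z)\}_{n=0}^\infty$ be the corresponding monic OPS for the Geronimus transformation $\mathcal{L}^{-*}$ of $\mathcal{L}$ at $\kappa$ (assumed to exist). If $\{P_n(z)\}_{n=0}^\infty$ is in a Nevai class $\mathcal{N}(a,c)$ (with $c\in\mathbb{R}$, $a\in[0,\infty)$), then $$\frac{P_n^{-*}(\kappa,z)}{P_{n-1}^{-*}(\kappa,z)}\longrightarrow f(z)=\frac{(z-c)+\sqrt{(z-c)^2-4a}}{2}$$ uniformly on compact subsets of $\mathbb{C}\setminus(\mathbb{R}\cup\{\kappa\})$.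
   Context: A linear functional $\mathcal{L}:\mathbb{C}[z]\to\mathbb{C}$ is positive-definite if $\mathcal{L}[p]>0$ for every polynomial $p$ that is not identically zero and is non-negative on $\mathbb{R}$. A monic orthogonal polynomial system (OPS) with respect to a functional $\mathcal{M}$ is a sequence of monic polynomials $p_n$ with $\deg p_n=n$, $\mathcal{M}[p_np_m]=0$ for $n\neq m$, and $\mathcal{M}[p_n^2]\neq0$ for all $n$. A monic OPS satisfies $p_0=1$, $p_1(z)=z-c_1$, $zp_n=p_{n+1}+c_{n+1}p_n+\lambda_{n+1}p_{n-1}$ for $n\ge1$. It is in the Nevai class $\mathcal{N}(a,c)$ if $c_n\to c$ and $\lambda_n\to a$. A Geronimus transformation of $\mathcal{L}$ at $\kappa$ is a linear functional $\mathcal{L}^{-*}$ with $\mathcal{L}^{-*}((z-\kappa)p(z))=\mathcal{L}(p(z))$ for all polynomials $p$; it is determined by the free parameter $s_0^*=\mathcal{L}^{-*}(1)$. Let $Q_n(z)=\mathcal{L}\left(\frac{P_n(z)-P_n(y)}{z-y}\right)_y$ (functional acting in $y$). The OPS of $\mathcal{L}^{-*}$ exists when $s_0^*\ne0$ and $s_0^*P_{n-1}(\kappa)+Q_{n-1}(\kappa)\neq0$ for all $n\ge1$, and then $P_0^{-*}=1$ and $$P_n^{-*}(\kappa,z)=P_n(z)-\frac{s_0^*P_n(\kappa)+Q_n(\kappa)}{s_0^*P_{n-1}(\kappa)+Q_{n-1}(\kappa)}P_{n-1}(z),\quad n\ge1.$$ The branch of the square root in $f$ is holomorphic on $\mathbb{C}\setminus\mathbb{R}$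 and behaves like $z+O(1)$ near $z=\infty$. Uniform convergence on a compact set $K$ is understood for all $n$ large enough (depending on $K$) that the denominators do not vanish on $K$. *)

(* Defs.v *)
From HB Require Import structures.
From mathcomp Require Import all_boot all_order all_algebra.
From mathcomp Require Import complex.
From mathcomp Require Import all_classical all_reals all_analysis.
Set Implicit Arguments. Unset Strict Implicit. Unset Printing Implicit Defensive.
Import Order.TTheory GRing.Theory Num.Theory.
Import numFieldNormedType.Exports.
Local Open Scope classical_set_scope.
Local Open Scope ring_scope.

(* Packing R[i] as a numClosedFieldType gives it the topology of the modulus,
   which the bare type R[i] does not carry. *)
Definition Cplx (R : realType) : numClosedFieldType :=
  [the numClosedFieldType of R[i]].

(* In a numClosedFieldType, [0 <= w] and [0 < w] entail that w is real, and
   [Num.real] is the real line. *)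
Definition positive_definite (C : numClosedFieldType) (L : {scalar {poly C}}) :=
  forall p : {poly C},
    p != 0 -> (forall x, x \is Num.real -> 0 <= p.[x]) -> 0 < L p.

(* Orthogonality is bilinear: no complex conjugation is involved. *)
Definition monic_OPS (C : numClosedFieldType) (M : {scalar {poly C}})
    (p : nat -> {poly C}) :=
  [/\ forall n, p n \is monic,
      forall n, size (p n) = n.+1,
      forall n m, n != m -> M (p n * p m) = 0 &
      forall n, M (p n * p n) != 0].

(* The values [cs 0], [lam 0] and [lam 1] play no role. *)
Definition three_term_recurrence (C : numClosedFieldType)
    (p : nat -> {poly C}) (cs lam : nat -> C) :=
  [/\ p 0%N = 1,
      p 1%N = 'X - (cs 1%N)%:P &
      forall n, (1 <= n)%N ->
        'X * p n = p n.+1 + cs n.+1 *: p n + lam n.+1 *: p n.-1].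

Definition Nevai_class (C : numClosedFieldType) (a c : C)
    (p : nat -> {poly C}) :=
  exists cs lam : nat -> C,
    [/\ three_term_recurrence p cs lam, cs @ \oo --> c & lam @ \oo --> a].

(* The free parameter s_0^* is [Ls 1]. *)
Definition Geronimus_transformation (C : numClosedFieldType)
    (L : {scalar {poly C}}) (kappa : C) (Ls : {scalar {poly C}}) :=
  forall p : {poly C}, Ls (('X - kappa%:P) * p) = L p.

(* These conditions determine w off the real line (they fix one sign on each
   half-plane) and leave its values on the real line arbitrary.
   [derivable w z 1] over the complex field is complex differentiability.
   B must be required to be real: [B <= `|z|] would never hold otherwise. *)
Definition sqrt_branch (C : numClosedFieldType) (a c : C) (w : C -> C) :=
  [/\ forall z, z \isn't Num.real -> w z ^+ 2 = (z - c) ^+ 2 - 4 * a,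
      forall z, z \isn't Num.real -> derivable w z 1 &
      exists B M : C, B \is Num.real /\
        forall z, z \isn't Num.real -> B <= `|z| -> `|w z - z| <= M].

(* Main.v *)
(* On a half-plane the ratios r_n = P_(n+1)(z) / P_n(z) satisfy
   r_(n+1) = z - c_(n+2) - lam_(n+2) / r_n and never leave that half-plane.
   The limiting Moebius map x |-> z - c - a / x has an attracting fixed point
   f in the half-plane and a repelling one, g, outside it. In the coordinate
   (x - f) / (x - g) it is multiplication by g / f, of modulus < 1 uniformly
   on compact sets, so that r_n -> f uniformly.

   Since Ls ((X - kappa) p) = L p, the moments T_n = Ls (P_n) satisfy the
   recurrence at kappa, and Ps_(n+1) = P_(n+1) - t_n P_n with
   t_n = T_(n+1) / T_n. By a Poincare-type dichotomy t_n tends to one of the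
   fixed points at kappa; calling it t and the other one t', we have
   (f - t) (f - t') = f (z - kappa), which keeps f away from t on compact sets
   avoiding kappa. Then
   Ps_(n+2) / Ps_(n+1) = r_n (r_(n+1) - t_(n+1)) / (r_n - t_n)
   has the same limit f as r_n. *)
Require Import Defs.
From HB Require Import structures.
From mathcomp Require Import all_boot all_order all_algebra.
From mathcomp Require Import complex ring lra.
From mathcomp Require Import all_classical all_reals all_analysis.
Set Implicit Arguments. Unset Strict Implicit. Unset Printing Implicit Defensive.
Import Order.TTheory GRing.Theory Num.Theory.
Import numFieldNormedType.Exports.
Local Open Scope classical_set_scope.
Local Open Scope ring_scope.

Local Notation Im := (@complex.Im _).
Local Notation Re := (@complex.Re _).
Local Notation "x %:C" := (real_complex _ x) : ring_scope.

(** * The modulus and half-planes *)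

(* [`|x|] itself has type [R[i]], where [lra] and [nra] do not apply. *)
Definition cnorm (R : realType) (x : R[i]) : R := Normc.normc x.

Lemma cnorm0 (R : realType) : cnorm (0 : R[i]) = 0.
Proof. exact: Normc.normc0. Qed.

Lemma cnorm1 (R : realType) : cnorm (1 : R[i]) = 1.
Proof. exact: Normc.normc1. Qed.

Lemma cnormM (R : realType) (x y : R[i]) : cnorm (x * y) = cnorm x * cnorm y.
Proof. exact: Normc.normcM. Qed.

Lemma cnormV (R : realType) (x : R[i]) : cnorm x^-1 = (cnorm x)^-1.
Proof. exact: Normc.normcV. Qed.

Lemma ImD (R : realType) (x y : R[i]) : Im (x + y) = Im x + Im y.
Proof. by case: x; case: y. Qed.

Lemma ImN (R : realType) (x : R[i]) : Im (- x) = - Im x.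
Proof. by case: x. Qed.

Lemma ImZ (R : realType) (l : R) (x : R[i]) : Im (l%:C * x) = l * Im x.
Proof. by case: x => p q /=; rewrite mul0r addr0. Qed.

Lemma sqr_cnorm (R : realType) (x : R[i]) :
  cnorm x ^+ 2 = Re x ^+ 2 + Im x ^+ 2.
Proof. by case: x => p q /=; rewrite sqr_sqrtr // addr_ge0 ?sqr_ge0. Qed.

Lemma cnorm_ge0 (R : realType) (x : R[i]) : 0 <= cnorm x.
Proof. by case: x => p q /=; exact: sqrtr_ge0. Qed.

Lemma cnorm_real (R : realType) (l : R) : cnorm l%:C = `|l|.
Proof. by rewrite /= expr0n addr0 sqrtr_sqr. Qed.

Lemma cnormD (R : realType) (x y : R[i]) : cnorm (x + y) <= cnorm x + cnorm y.
Proof. exact: le_normcD. Qed.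

Lemma cnormN (R : realType) (x : R[i]) : cnorm (- x) = cnorm x.
Proof. exact: normcN. Qed.

Lemma cnormB (R : realType) (x y : R[i]) : cnorm (x - y) <= cnorm x + cnorm y.
Proof. by rewrite -(cnormN y) cnormD. Qed.

Lemma cnorm_dist (R : realType) (x y : R[i]) :
  cnorm (x - y) = cnorm (y - x).
Proof. by rewrite -cnormN opprB. Qed.

Lemma cnorm_gt0 (R : realType) (x : R[i]) : (0 < cnorm x) = (x != 0).
Proof.
rewrite lt0r cnorm_ge0 andbT; congr (~~ _); apply/eqP/eqP => [|->].
  exact: Normc.eq0_normc.
exact: cnorm0.
Qed.

Lemma Im_inv (R : realType) (x : R[i]) : Im x^-1 = - Im x / cnorm x ^+ 2.
Proof. by rewrite sqr_cnorm; case: x => p q /=; rewrite mulNr. Qed.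

Lemma Im_div_real (R : realType) (l : R) (x : R[i]) :
  Im (l%:C / x) = - (l / cnorm x ^+ 2 * Im x).
Proof. by rewrite ImZ Im_inv; ring. Qed.

Lemma signed_Im_le (R : realType) (s : R) (x : R[i]) :
  s * s = 1 -> s * Im x <= cnorm x.
Proof.
move=> ss; apply: le_trans (ler_norm _) _; rewrite -sqrtr_sqr.
rewrite -(ger0_norm (cnorm_ge0 x)) -sqrtr_sqr ler_wsqrtr // sqr_cnorm.
by rewrite exprMn (expr2 s) ss mul1r lerDr sqr_ge0.
Qed.

Lemma signed_Im_neq0 (R : realType) (s : R) (x : R[i]) :
  0 < s * Im x -> x != 0.
Proof. by case: eqP => // -> /=; rewrite mulr0 ltxx. Qed.

(** * The perturbed Moebius recursion *)

(* The Moebius recursion of the ratios preserves the half-plane of [z]. *)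
Lemma Im_ratio_step (R : realType) (s c l : R) (z x : R[i]) :
  0 <= l -> 0 <= s * Im x -> s * Im z <= s * Im (z - c%:C - l%:C / x).
Proof.
move=> l0 x0; rewrite !ImD !ImN Im_div_real /= subr0 opprK mulrDr lerDl.
by rewrite mulrCA; apply: mulr_ge0 => //; apply: divr_ge0 => //; exact: sqr_ge0.
Qed.

(* [f] and [g] are the attracting and repelling fixed points of
   [x |-> z - c - a / x]; [s] is the sign of the half-plane of [z]. *)
Definition fixed_points (R : realType) (s a c : R) (z f g : R[i]) :=
  [/\ f + g = z - c%:C, f * g = a%:C, 0 < s * Im z & 0 < s * Im f].

(** As [g = a / f] with [a >= 0], inversion puts [g] in the closed half-plane opposite to [f]; since
    [c] is real, the imaginary parts of [f] and [g] add up to that of [z]. *)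
Lemma fixed_points_Im (R : realType) (s a c : R) (z f g : R[i]) :
  0 <= a -> fixed_points s a c z f g ->
  s * Im g <= 0 /\ s * Im z <= s * Im f.
Proof.
move=> a0 [fDg fMg z0 f0]; have fN0 := signed_Im_neq0 f0.
have gE : g = a%:C / f by rewrite -fMg mulrAC mulfV // mul1r.
have g0 : s * Im g <= 0.
  rewrite gE Im_div_real mulrN oppr_le0 mulrCA.
  apply: mulr_ge0; last exact: ltW.
  by apply: divr_ge0 => //; exact: sqr_ge0.
split=> //; have : s * Im (f + g) = s * Im z.
  by rewrite fDg ImD ImN /= subr0.
by rewrite ImD mulrDr => <-; rewrite gerDl.
Qed.

Lemma fixed_points_norm (R : realType) (s a c y : R) (z f g : R[i]) :
  s * s = 1 -> 0 <= a -> fixed_points s a c z f g -> 0 < y -> y <= s * Im z ->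
  [/\ y <= cnorm f, cnorm g <= a / y & cnorm f <= cnorm z + `|c| + a / y].
Proof.
move=> ss a0 fp y0 yz; have [_ zf] := fixed_points_Im a0 fp.
have yf : y <= cnorm f.
  by rewrite (le_trans yz) // (le_trans zf) // signed_Im_le.
case: fp => fDg fMg _ _.
have ng : cnorm g <= a / y.
  rewrite ler_pdivlMr // (le_trans (ler_wpM2l (cnorm_ge0 g) yf)) //.
  by rewrite -cnormM mulrC fMg cnorm_real ger0_norm.
split=> //; have -> : f = z - c%:C - g by rewrite -fDg addrK.
rewrite (le_trans (cnormB _ _)) // lerD // (le_trans (cnormB _ _)) //.
by rewrite cnorm_real.
Qed.

(* The multiplier is [g / f = a / f^2], and [Im z = (1 - a / |f|^2) Im f]. *)
Lemma multiplier_le (R : realType) (s a c y B : R) (z f g : R[i]) :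
  s * s = 1 -> 0 <= a -> fixed_points s a c z f g -> 0 < y -> y <= s * Im z ->
  cnorm f <= B -> cnorm (g / f) <= 1 - y / B.
Proof.
move=> ss a0 fp y0 yz fB.
have [yf _ _] := fixed_points_norm ss a0 fp y0 yz.
have f0 : 0 < cnorm f by exact: lt_le_trans yf.
have B0 : 0 < B by exact: lt_le_trans fB.
case: (fp) => fDg fMg z0 If0; have fN0 := signed_Im_neq0 If0.
have gE : g = a%:C / f by rewrite -fMg mulrAC mulfV // mul1r.
have -> : cnorm (g / f) = a / cnorm f ^+ 2.
  rewrite gE !cnormM !cnormV cnorm_real ger0_norm //.
  by rewrite expr2 invfM mulrA.
have zE : s * Im z = s * Im f * (1 - a / cnorm f ^+ 2).
  have : s * Im (f + g) = s * Im z by rewrite fDg ImD ImN /= subr0.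
  by rewrite ImD gE Im_div_real => <-; ring.
set k := a / _ in zE *.
have k1 : 0 < 1 - k by move: z0; rewrite zE pmulr_rgt0.
suff : y / B <= 1 - k by lra.
rewrite ler_pdivrMr // (le_trans yz) // zE mulrC ler_wpM2l ?(ltW k1) //.
exact: le_trans (signed_Im_le _ ss) fB.
Qed.

(** With [m = f + g - f * g / x], the quotient [(m - f) / (m - g)] is [g / f] times the coordinate
    of [x], and [(m - g) / (x' - g)] is [1 - e / (x' - g)]. *)
Lemma mobius_coordinate_step (F : fieldType) (f g x x' e : F) :
  x != 0 -> f != 0 -> x - g != 0 -> x' - g != 0 ->
  e = x' - (f + g - f * g / x) ->
  (x' - f) / (x' - g) =
  g / f * ((x - f) / (x - g)) * (1 - e / (x' - g)) + e / (x' - g).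
Proof. by move=> x0 f0 xg x'g ->; field; rewrite x0 f0 xg x'g. Qed.

Lemma mobius_contraction (R : realType) (f g x x' : R[i]) (q y d : R) :
  0 < y -> x != 0 -> f != 0 -> y <= cnorm (x - g) -> y <= cnorm (x' - g) ->
  cnorm (x' - (f + g - f * g / x)) <= d -> cnorm (g / f) <= q ->
  cnorm ((x' - f) / (x' - g)) <=
  q * cnorm ((x - f) / (x - g)) * (1 + d / y) + d / y.
Proof.
move=> y0 x0 f0 xg x'g ed gq.
have xg0 : x - g != 0 by rewrite -cnorm_gt0 (lt_le_trans y0).
have x'g0 : x' - g != 0 by rewrite -cnorm_gt0 (lt_le_trans y0).
rewrite (mobius_coordinate_step x0 f0 xg0 x'g0 erefl).
set e := x' - (f + g - _) in ed *; set u := (x - f) / _.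
have ey : cnorm (e / (x' - g)) <= d / y.
  rewrite cnormM cnormV ler_pM ?invr_ge0 ?cnorm_ge0 //.
  by rewrite lef_pV2 // posrE // (lt_le_trans y0).
rewrite (le_trans (cnormD _ _)) // lerD // !(cnormM _ (1 - _)).
rewrite ler_pM ?cnorm_ge0 // ?(cnormM (g / f)).
  by rewrite ler_wpM2r ?cnorm_ge0.
by rewrite (le_trans (cnormB _ _)) // cnorm1 lerD2l.
Qed.

(** The constant [e / (1 - q)] is the fixed point of [t |-> q * t + e]. *)
Lemma affine_iter_le (R : realType) (q e B : R) (k : nat) (b : nat -> R) :
  0 <= q -> q < 1 -> b 0%N <= B -> 0 <= e ->
  (forall j, (j < k)%N -> b j.+1 <= q * b j + e) ->
  b k <= q ^+ k * B + e / (1 - q).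
Proof.
move=> q0 q1 b0 e0; have q1' : 0 < 1 - q by rewrite subr_gt0.
elim: k => [|k IH] bk.
  by rewrite expr0 mul1r (le_trans b0) // lerDl divr_ge0 // ltW.
rewrite (le_trans (bk k _)) //.
have := IH (fun j jk => bk j (leqW jk)).
move=> /(ler_wpM2l q0); rewrite -(lerD2r e) => /le_trans; apply.
rewrite mulrDr mulrA -exprS -addrA lerD2l le_eqVlt; apply/orP; left; apply/eqP.
by field; rewrite gt_eqF.
Qed.

Lemma cvg0_bound (R : realType) (d : nat -> R) :
  d @ \oo --> (0 : R) ->
  forall e, 0 < e -> exists N, forall n, (N <= n)%N -> d n <= e.
Proof.
move=> /cvgrPdist_le d0 e e0; have [N _ Nd] := d0 e e0.
by exists N => n /Nd; rewrite /= sub0r normrN => /ler_normlW.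
Qed.

(* In the backward case the bound on [b n] comes from [b (n + k)] with [k]
   large, so that [B] is contracted away. *)
Lemma perturbed_contraction_vanish (R : realType) (q B : R) (d : nat -> R) :
  0 <= q -> q < 1 -> 0 < B -> d @ \oo --> (0 : R) ->
  forall e, 0 < e -> exists N, forall b : nat -> R,
  (forall n, 0 <= b n <= B) ->
  (forall n, b n.+1 <= q * b n * (1 + d n) + d n) \/
  (forall n, b n <= q * b n.+1 * (1 + d n) + d n) ->
  forall n, (N <= n)%N -> b n <= e.
Proof.
move=> q0 q1 B0 d0 e e0; have q1' : 0 < 1 - q by rewrite subr_gt0.
have B1 : 0 < 1 + B by rewrite addr_gt0.
(* Iterating costs [e' / (1 - q) = e / 2], which leaves [e / 2] for the contracted initial bound. *)
pose e' := e / 2 * (1 - q); have e'0 : 0 < e' by rewrite !mulr_gt0.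
have [N1 dN] := cvg0_bound d0 (divr_gt0 e'0 B1).
have [N2 qN] : exists k, q ^+ k * B <= e / 2.
  have : (fun k => q ^+ k * B) @ \oo --> 0 * B.
    by apply: cvgMl; apply: cvg_expr; rewrite ger0_norm.
  rewrite mul0r => /cvg0_bound /(_ (e / 2)).
  by rewrite divr_gt0 // => /(_ isT) [k Hk]; exists k; exact: Hk.
(* Past [N1], the perturbation [d n * (q * u + 1)] is at most [e'], because
   [d n * (1 + B) <= e']. *)
have step n u v : (N1 <= n)%N -> 0 <= u <= B ->
    v <= q * u * (1 + d n) + d n -> v <= q * u + e'.
  move=> nN /andP[u0 uB] /le_trans; apply.
  rewrite mulrDr mulr1 -addrA lerD2l.
  have dn := dN n nN; rewrite ler_pdivlMr // in dn.
  have [dn0|dn0] := leP 0 (d n).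
    apply: le_trans dn; rewrite mulrDr mulr1 addrC lerD2l mulrC.
    rewrite ler_wpM2l //; apply: le_trans uB.
    by rewrite ler_piMl // ltW.
  rewrite (le_trans _ (ltW e'0)) // -{2}(mul1r (d n)) -mulrDl.
  by rewrite mulr_ge0_le0 ?addr_ge0 ?mulr_ge0 // ltW.
have fin : q ^+ N2 * B + e' / (1 - q) <= e.
  by rewrite /e' mulfK ?gt_eqF //; move: qN; lra.
exists (N1 + N2)%N => b bB H n Nn; apply: le_trans fin.
case: H => H.
  have := @affine_iter_le _ q e' B N2 (fun j => b (n - N2 + j)%N) q0 q1.
  rewrite subnK ?(leq_trans _ Nn) ?leq_addl //; apply.
  - by case/andP: (bB (n - N2 + 0)%N).
  - exact: ltW.
  - move=> j _; rewrite addnS; apply: (step (n - N2 + j)%N) => //.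
    rewrite (leq_trans _ (leq_addr _ _)) //.
    by rewrite leq_subRL ?(leq_trans _ Nn) ?leq_addl // addnC.
have := @affine_iter_le _ q e' B N2 (fun j => b (n + (N2 - j))%N) q0 q1.
rewrite subnn addn0; apply.
- by case/andP: (bB (n + (N2 - 0))%N).
- exact: ltW.
- move=> j jN; apply: (step (n + (N2 - j.+1))%N).
  + by rewrite (leq_trans _ (leq_addr _ _)) // (leq_trans _ Nn) ?leq_addr.
  + exact: bB.
  + by have := H (n + (N2 - j.+1))%N; rewrite -addnS subnSK.
Qed.

(** Choosing [N] before [z], [f], [g] and the orbit is what later makes the convergence uniform on
    compact sets. The alternative covers recursions solved forwards and backwards. *)
Lemma perturbed_orbit_limit (R : realType) (s a c y B : R) (d : nat -> R) :
  s * s = 1 -> 0 <= a -> 0 < y -> 0 < B -> d @ \oo --> (0 : R) ->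
  forall e, 0 < e -> exists N, forall (z f g : R[i]) (x : nat -> R[i]),
  fixed_points s a c z f g -> y <= s * Im z -> cnorm f <= B ->
  (forall n, y <= s * Im (x n)) ->
  (forall n, cnorm (x n.+1 - (f + g - f * g / x n)) <= d n) \/
  (forall n, cnorm (x n - (f + g - f * g / x n.+1)) <= d n) ->
  forall n, (N <= n)%N -> cnorm (x n - f) <= e.
Proof.
move=> ss a0 y0 B0 d0 e e0.
(* The maximum keeps [q] non-negative while no [f] is given that would force [y <= B]; [D] will
   bound [|f - g|]. *)
pose q := Num.max 0 (1 - y / B); pose D := B + a / y.
have D0 : 0 < D by rewrite ltr_wpDr // divr_ge0 // ltW.
have q0 : 0 <= q by rewrite le_max lexx.
have q1 : q < 1 by rewrite gt_max ltr01 gtrBl divr_gt0.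
have B'0 : 0 < 1 + D / y by rewrite addr_gt0 // divr_gt0.
have d'0 : (fun n => d n / y) @ \oo --> (0 : R).
  by rewrite -(mul0r y^-1); apply: cvgMl.
(* For [b <= 1 / 2], the bound [|x - f| = b * |x - g| <= b * (|x - f| + D)] gives
   [|x - f| <= 2 * D * b]. *)
pose e' := Num.min (1 / 2) (e / (2 * D)).
have e'0 : 0 < e' by rewrite lt_min !divr_gt0 // mulr_gt0.
have [N HN] := perturbed_contraction_vanish q0 q1 B'0 d'0 e'0.
exists N => z f g x fp yz fB yx H n Nn.
have [yf gB _] := fixed_points_norm ss a0 fp y0 yz.
have [g0 _] := fixed_points_Im a0 fp.
have f0 : f != 0 by rewrite (@signed_Im_neq0 _ s) //; case: fp.
have x0 m : x m != 0 by apply: (@signed_Im_neq0 _ s); exact: lt_le_trans (yx m).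
(* The pole [g] of the coordinate lies in the opposite closed half-plane. *)
have xg m : y <= cnorm (x m - g).
  apply: le_trans (signed_Im_le _ ss); rewrite ImD ImN mulrDr mulrN.
  by have := yx m; lra.
have xg0 m : 0 < cnorm (x m - g) by exact: lt_le_trans (xg m).
have gfq : cnorm (g / f) <= q.
  by rewrite le_max (multiplier_le ss a0 fp y0 yz fB) orbT.
have fgD : cnorm (f - g) <= D.
  by rewrite (le_trans (cnormB _ _)) // lerD.
pose b m := cnorm ((x m - f) / (x m - g)).
have bn : b n <= e'.
  apply: HN Nn.
    move=> m; rewrite cnorm_ge0 /b /=.
    have -> : (x m - f) / (x m - g) = 1 - (f - g) / (x m - g).
      by field; rewrite -cnorm_gt0.
    rewrite (le_trans (cnormB _ _)) // cnorm1 lerD2l cnormM cnormV.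
    by rewrite ler_pM ?invr_ge0 ?cnorm_ge0 // lef_pV2 ?posrE.
  case: H => H; [left|right] => m; exact: mobius_contraction.
have bE : cnorm (x n - f) = b n * cnorm (x n - g).
  by rewrite -cnormM divfK // -cnorm_gt0.
have xgn : cnorm (x n - g) <= cnorm (x n - f) + D.
  rewrite (_ : x n - g = x n - f + (f - g)); last by ring.
  by rewrite (le_trans (cnormD _ _)) // lerD2l.
have b0 : 0 <= b n by exact: cnorm_ge0.
have bh : b n <= 1 / 2 by apply: le_trans bn _; rewrite ge_min lexx.
have be : b n * (2 * D) <= e.
  rewrite -ler_pdivlMr ?mulr_gt0 //.
  by apply: le_trans bn _; rewrite ge_min lexx orbT.
have := cnorm_ge0 (x n - f); move: bE xgn bh be; clear -b0 D0; nra.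
Qed.

Lemma cvg_dist0 (R : realType) (u : nat -> R) (l : R) :
  u @ \oo --> l -> (fun n => `|u n - l|) @ \oo --> (0 : R).
Proof.
move=> ul; rewrite -(normr0 R) -(subrr l).
by apply: cvg_norm; apply: cvgB => //; exact: cvg_cst.
Qed.

Lemma cvg_coef_error (R : realType) (y c a : R) (C L : nat -> R) :
  C @ \oo --> c -> L @ \oo --> a ->
  (fun n => `|C n - c| + `|L n - a| / y) @ \oo --> (0 : R).
Proof.
move=> Cc La; rewrite -(addr0 (0 : R)) -{2}(mul0r y^-1).
by apply: cvgD; [|apply: cvgMl]; exact: cvg_dist0.
Qed.

(** Passing to the limit coefficients changes the step by [(C - c) + (L - a) / x] up to sign, and
    [|x|] is at least [y]. *)
Lemma coef_error_le (R : realType) (s y c a C L : R) (z f g x : R[i]) :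
  s * s = 1 -> fixed_points s a c z f g -> 0 < y -> y <= s * Im x ->
  cnorm ((z - C%:C - L%:C / x) - (f + g - f * g / x)) <=
  `|C - c| + `|L - a| / y.
Proof.
move=> ss [-> -> _ _] y0 yx.
have xy : y <= cnorm x by exact: le_trans (signed_Im_le _ ss).
have -> : z - C%:C - L%:C / x - (z - c%:C - a%:C / x) =
    - (C - c)%:C - (L - a)%:C / x by rewrite !rmorphB /=; ring.
rewrite (le_trans (cnormB _ _)) // cnormN cnormM cnormV !cnorm_real lerD2l.
by rewrite ler_wpM2l // lef_pV2 ?posrE // (lt_le_trans y0).
Qed.

Lemma ratio_limit (R : realType) (s a c y B : R) (C L : nat -> R) :
  s * s = 1 -> 0 <= a -> 0 < y -> 0 < B ->
  C @ \oo --> c -> L @ \oo --> a -> (forall n, 0 <= L n) ->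
  forall e, 0 < e -> exists N, forall (z f g : R[i]) (x : nat -> R[i]),
  fixed_points s a c z f g -> y <= s * Im z -> cnorm f <= B ->
  s * Im z <= s * Im (x 0%N) ->
  (forall n, x n.+1 = z - (C n)%:C - (L n)%:C / x n) ->
  forall n, (N <= n)%N -> cnorm (x n - f) <= e.
Proof.
move=> ss a0 y0 B0 Cc La L0 e e0.
have [N HN] :=
  perturbed_orbit_limit c ss a0 y0 B0 (cvg_coef_error y Cc La) e0.
exists N => z f g x fp yz fB x0 xS.
have zx n : s * Im z <= s * Im (x n).
  elim: n => // n IH; rewrite xS Im_ratio_step // (le_trans _ IH) //.
  by rewrite (le_trans _ yz) // ltW.
have yx n : y <= s * Im (x n) by exact: le_trans (zx n).
apply: (HN z f g) => //; left => n; rewrite xS.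
exact: coef_error_le fp y0 (yx n).
Qed.

Lemma cvg_shift (R : realType) (u : nat -> R) (l : R) (m : nat) :
  u @ \oo --> l -> (fun n => u (m + n)%N) @ \oo --> l.
Proof.
move=> ul; rewrite (_ : (fun n => _) = [sequence u (n + m)%N]_n).
  by rewrite cvg_shiftn.
by apply/funext => n; rewrite addnC.
Qed.

(* Either the orbit enters the half-plane of [z], where [f] attracts, or it
   stays in the complement; then [z - C n - x (n + 1)] stays in the half-plane
   and solves the recursion backwards, so that it tends to [f]. *)
Lemma ratio_limit_dichotomy (R : realType) (s a c : R) (C L : nat -> R)
    (z f g : R[i]) (x : nat -> R[i]) :
  s * s = 1 -> 0 <= a -> C @ \oo --> c -> L @ \oo --> a ->
  (forall n, 0 <= L n) -> fixed_points s a c z f g -> (forall n, x n != 0) ->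
  (forall n, x n.+1 = z - (C n)%:C - (L n)%:C / x n) ->
  exists t t', [/\ t + t' = f + g, t * t' = f * g &
    forall e, 0 < e -> exists N, forall n, (N <= n)%N -> cnorm (x n - t) <= e].
Proof.
move=> ss a0 Cc La L0 fp x0 xS.
have y0 : 0 < s * Im z by case: fp.
have [yf _ _] := fixed_points_norm ss a0 fp y0 (lexx _).
have B0 : 0 < cnorm f by exact: lt_le_trans yf.
have [[m xm]|nx] := pselect (exists m, 0 < s * Im (x m)).
  exists f, g; split=> // e e0.
  (* Only one step after entering the half-plane is the signed imaginary part known to be at least
     that of [z]; hence the start at [m.+1]. *)
  have [N HN] := ratio_limit ss a0 y0 B0 (cvg_shift m.+1 Cc)
    (cvg_shift m.+1 La) (fun n => L0 _) e0.
  exists (m.+1 + N)%N => n Nn.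
  have mn : (m.+1 <= n)%N by exact: leq_trans (leq_addr _ _) Nn.
  have := HN z f g (fun n => x (m.+1 + n)%N) fp (lexx _) (lexx _) _ _ (n - m.+1)%N.
  rewrite subnKC //; apply.
  - by rewrite addn0 xS Im_ratio_step // ltW.
  - by move=> k; rewrite addnS xS.
  - by rewrite leq_subRL.
have xle n : s * Im (x n) <= 0.
  by rewrite leNgt; apply/negP => xn; apply: nx; exists n.
exists g, f; split; [by rewrite addrC | by rewrite mulrC|] => e e0.
have e20 : 0 < e / 2 by rewrite divr_gt0.
pose v n := z - (C n)%:C - x n.+1.
have vx n : v n = (L n)%:C / x n by rewrite /v xS; ring.
have yv n : s * Im z <= s * Im (v n).
  by rewrite /v !ImD !ImN /= subr0 mulrDr mulrN lerDl oppr_ge0.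
have v0 n : v n != 0 by apply: (@signed_Im_neq0 _ s); exact: lt_le_trans (yv n).
have xv n : x n = (L n)%:C / v n.
  have := v0 n; rewrite vx => Lx; rewrite invf_div mulrCA mulfV ?mulr1 //.
  by apply: contra_neq Lx => ->; rewrite mul0r.
have vS n : v n = z - (C n)%:C - (L n.+1)%:C / v n.+1 by rewrite -xv.
(* Solved backwards, the recursion of [v] pairs [C n] with [L n.+1]; hence the shift of [L] by
   one. *)
have [N HN] := perturbed_orbit_limit c ss a0 y0 B0
  (cvg_coef_error (s * Im z) Cc (cvg_shift 1 La)) e20.
have [M HM] : exists M, forall n, (M <= n)%N -> `|C n - c| <= e / 2.
  by apply: cvg0_bound => //; exact: cvg_dist0.
exists (N + M).+1 => -[//|n] Nn.
have vn : cnorm (v n - f) <= e / 2.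
  apply: (HN z f g) => //; last by rewrite (leq_trans (leq_addr M N)).
  by right=> k; rewrite {1}vS; exact: coef_error_le fp y0 (yv _).
have -> : x n.+1 - g = - (C n - c)%:C - (v n - f).
  have -> : g = z - c%:C - f by case: (fp) => <- _ _ _; rewrite addrC addKr.
  by rewrite /v rmorphB /=; ring.
rewrite (le_trans (cnormB _ _)) // (splitr e) lerD // cnormN cnorm_real HM //.
by rewrite (leq_trans (leq_addl N M)).
Qed.

(** Both [t] and [t'] are the roots of [X^2 - (k - c) X + a]. At [f], a root of
    [X^2 - (z - c) X + a], this polynomial takes the value [f (z - k)], and [|f - t'|] is at most
    [B + B']. *)
Lemma fixed_points_separation (R : realType) (s s' a c y d B B' : R)
    (z f g k f' g' t t' : R[i]) :
  s * s = 1 -> s' * s' = 1 -> 0 <= a -> fixed_points s a c z f g ->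
  fixed_points s' a c k f' g' -> t + t' = f' + g' -> t * t' = f' * g' ->
  0 < y -> y <= s * Im z -> 0 <= d -> d <= cnorm (z - k) -> cnorm f <= B ->
  cnorm t' <= B' -> y * d / (B + B') <= cnorm (f - t).
Proof.
move=> ss ss' a0 fp [Dk Mk _ _] tD tM y0 yz d0 dz fB tB.
have [yf _ _] := fixed_points_norm ss a0 fp y0 yz.
have BB' : 0 < B + B'.
  rewrite ltr_pwDl // ?(lt_le_trans y0 (le_trans yf fB)) //.
  exact: le_trans (cnorm_ge0 _) tB.
case: fp => Dz Mz _ _.
have key : (f - t) * (f - t') = f * (z - k).
  have -> : (f - t) * (f - t') = f ^+ 2 - (t + t') * f + t * t' by ring.
  rewrite tD tM Dk Mk -Mz; have -> : k - c%:C = f + g - (z - k).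
    by rewrite Dz; ring.
  by ring.
rewrite ler_pdivrMr //.
have -> : y * d = d * y by rewrite mulrC.
apply: (@le_trans _ _ (cnorm ((f - t) * (f - t')))).
  by rewrite key cnormM [X in _ <= X]mulrC ler_pM // ltW.
rewrite cnormM ler_wpM2l ?cnorm_ge0 //.
by rewrite (le_trans (cnormB _ _)) // lerD.
Qed.

(** The fraction [(r1 - t1) / (r0 - t0)] differs from 1 by a numerator of modulus at most [4 e] over
    a denominator of modulus at least [D / 2], whence the factor [8 / D]. *)
Lemma quotient_perturbation (R : realType) (B D e : R)
    (r0 r1 t0 t1 f t : R[i]) :
  0 < D -> 0 < e -> e <= 1 -> e <= D / 4 -> D <= cnorm (f - t) ->
  cnorm f <= B ->
  cnorm (r0 - f) <= e -> cnorm (r1 - f) <= e ->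
  cnorm (t0 - t) <= e -> cnorm (t1 - t) <= e ->
  r0 - t0 != 0 /\
  cnorm (r0 * (r1 - t1) / (r0 - t0) - f) <= e * (1 + (B + 1) * (8 / D)).
Proof.
move=> D0 e0 e1 eD Dft fB r0f r1f t0t t1t.
have rt : D / 2 <= cnorm (r0 - t0).
  have : cnorm (f - t) <= cnorm (r0 - t0) + e + e.
    have -> : f - t = (r0 - t0) - (r0 - f) + (t0 - t) by ring.
    by rewrite (le_trans (cnormD _ _)) // lerD // (le_trans (cnormB _ _)) // lerD.
  by lra.
have rt0 : r0 - t0 != 0 by rewrite -cnorm_gt0 (lt_le_trans _ rt) // divr_gt0.
split=> //.
have -> : r0 * (r1 - t1) / (r0 - t0) - f =
    (r0 - f) + r0 * (((r1 - f) - (r0 - f) - ((t1 - t) - (t0 - t))) / (r0 - t0)).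
  by field.
rewrite (le_trans (cnormD _ _)) // mulrDr mulr1 lerD //.
have r0B : cnorm r0 <= B + 1.
  have -> : r0 = f + (r0 - f) by ring.
  by rewrite (le_trans (cnormD _ _)) // lerD // (le_trans r0f).
have -> : e * ((B + 1) * (8 / D)) = (B + 1) * ((e + e + (e + e)) / (D / 2)).
  by field; rewrite gt_eqF.
rewrite cnormM ler_pM ?cnorm_ge0 // cnormM cnormV ler_pM ?invr_ge0 ?cnorm_ge0 //.
  by rewrite (le_trans (cnormB _ _)) // lerD // (le_trans (cnormB _ _)) // lerD.
by rewrite lef_pV2 // posrE ?cnorm_gt0 // divr_gt0.
Qed.

(** * Orthogonal polynomials and the Geronimus transformation *)

(* With [Num.real] in place of the underlying predicate, the closure properties
   of [polyOver] are not inferred. *)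
Local Notation real_poly := (polyOver (@Num.Def.real_num_pred _)).

Lemma size_sub_lead (F : fieldType) (p q : {poly F}) (k : nat) :
  p \is monic -> size p = k.+1 -> (size q <= k.+1)%N ->
  (size (q - q`_k *: p)%R <= k)%N.
Proof.
move=> /monicP pm ps qs; apply/leq_sizeP => j; rewrite leq_eqVlt coefB coefZ.
case/orP=> [/eqP <-|kj].
  by move: pm; rewrite lead_coefE ps /= => ->; rewrite mulr1 subrr.
rewrite (nth_default 0 (leq_trans qs kj)) (@nth_default _ 0 p) ?ps //.
by rewrite mulr0 subrr.
Qed.

(** Subtracting a multiple of [p k] lowers the size, so that [q] is used up by multiples of [p k]
    with [k < n], all orthogonal to [p n]. *)
Lemma OPS_orthogonal_low (C : numClosedFieldType) (M : {scalar {poly C}})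
    (p : nat -> {poly C}) (n : nat) (q : {poly C}) :
  monic_OPS M p -> (size q <= n)%N -> M (p n * q) = 0.
Proof.
move=> [pm ps po _] qn.
have : forall k, (k <= n)%N ->
    forall r : {poly C}, (size r <= k)%N -> M (p n * r) = 0.
  elim=> [_ r|k IH kn r rk].
    by rewrite leqn0 size_poly_eq0 => /eqP ->; rewrite mulr0 linear0.
  rewrite -(subrK (r`_k *: p k) r) mulrDr linearD /= IH ?(ltnW kn) //; last first.
    exact: size_sub_lead.
  by rewrite -scalerAr linearZ /= po ?gtn_eqF // mulr0 addr0.
by move=> H; exact: (H n).
Qed.

Lemma OPS_orthogonal_eq0 (C : numClosedFieldType) (M : {scalar {poly C}})
    (p : nat -> {poly C}) (k : nat) (q : {poly C}) :
  monic_OPS M p -> (size q <= k)%N ->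
  (forall m, (m < k)%N -> M (p m * q) = 0) -> q = 0.
Proof.
move=> opsp; have [pm ps po pn] := opsp; elim: k q => [|k IH] q qk qo.
  by apply/eqP; rewrite -size_poly_eq0 -leqn0.
have q'0 : q - q`_k *: p k = 0.
  apply: IH => [|m mk]; first exact: size_sub_lead.
  rewrite mulrBr linearB /= qo ?(leqW mk) // -scalerAr linearZ /= po.
    by rewrite mulr0 subr0.
  by rewrite ltn_eqF.
move/eqP: q'0; rewrite subr_eq0 => /eqP qE.
have := qo k (ltnSn k); rewrite qE -scalerAr linearZ /= => /eqP.
by rewrite mulf_eq0 (negPf (pn k)) orbF => /eqP ->; rewrite scale0r.
Qed.

Lemma OPS_0 (C : numClosedFieldType) (M : {scalar {poly C}})
    (p : nat -> {poly C}) : monic_OPS M p -> p 0%N = 1.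
Proof.
move=> [pm ps _ _]; have := pm 0%N.
have /eqP/size_poly1P[c _ ->] := ps 0%N.
by rewrite monicE lead_coefC => /eqP ->; rewrite polyC1.
Qed.

Lemma size_sub_monic (F : fieldType) (p q : {poly F}) (k : nat) :
  p \is monic -> q \is monic -> size p = k.+1 -> size q = k.+1 ->
  (size (q - p)%R <= k)%N.
Proof.
move=> pm qm ps qs; have := size_sub_lead pm ps (eq_leq qs).
by move/monicP: qm; rewrite lead_coefE qs /= => ->; rewrite scale1r.
Qed.

(** Polarization writes [p] as a real combination of two squares of real polynomials, on which [L]
    is real. *)
Lemma positive_definite_real (C : numClosedFieldType) (L : {scalar {poly C}})
    (p : {poly C}) :
  positive_definite L -> p \is a real_poly -> L p \is Num.real.
Proof.
move=> Lp pr; have sq_real (q : {poly C}) :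
    q \is a real_poly -> L (q * q) \is Num.real.
  move=> qr; have [->|q0] := eqVneq q 0; first by rewrite mulr0 linear0 real0.
  apply/gtr0_real/Lp => [|x xr]; first by rewrite mulf_neq0.
  by rewrite hornerM -expr2 real_exprn_even_ge0 // rpred_horner.
have -> : p = 4^-1 *: ((p + 1) * (p + 1) - (p - 1) * (p - 1)).
  rewrite (_ : _ - _ = 4 *: p); last first.
    by rewrite -mulr_algl scaler_nat; ring.
  by rewrite scalerA mulVf ?scale1r // pnatr_eq0.
have r4 : 4^-1 \is @Num.real C by rewrite rpredV realn.
rewrite linearZ linearB /=; apply: rpredM => //; apply: rpredB; apply: sq_real.
  by rewrite rpredD ?rpred1.
by rewrite rpredB ?rpred1.
Qed.

Lemma positive_definite_sqr (C : numClosedFieldType) (L : {scalar {poly C}})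
    (p : {poly C}) :
  positive_definite L -> p \is a real_poly -> p != 0 -> 0 < L (p * p).
Proof.
move=> Lp pr p0; apply: Lp => [|x xr]; first by rewrite mulf_neq0.
by rewrite hornerM -expr2 real_exprn_even_ge0 // rpred_horner.
Qed.

Lemma recurrence_diag (C : numClosedFieldType) (L : {scalar {poly C}})
    (p : nat -> {poly C}) (cs lam : nat -> C) (n : nat) :
  monic_OPS L p -> three_term_recurrence p cs lam ->
  L ('X * p n * p n) = cs n.+1 * L (p n * p n).
Proof.
move=> [_ _ po _] [p0 p1 pS]; case: n => [|n].
  have -> : 'X * p 0%N = p 1%N + cs 1%N *: p 0%N.
    by rewrite p1 p0 mulr1 alg_polyC subrK.
  by rewrite mulrDl linearD /= po // add0r -scalerAl linearZ.
rewrite pS // !mulrDl !linearD /= -!scalerAl !linearZ /=.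
by rewrite (po n.+2) ?gtn_eqF // (po n) ?ltn_eqF // mulr0 addr0 add0r.
Qed.

(** Since [X p_n] and [p_(n+1)] are monic of the same size, their difference is orthogonal to
    [p_(n+1)]; the factor [X] is then moved onto [p_(n+1)], where the recurrence applies. *)
Lemma recurrence_offdiag (C : numClosedFieldType) (L : {scalar {poly C}})
    (p : nat -> {poly C}) (cs lam : nat -> C) (n : nat) :
  monic_OPS L p -> three_term_recurrence p cs lam ->
  L (p n.+1 * p n.+1) = lam n.+2 * L (p n * p n).
Proof.
move=> ops [p0 p1 pS]; have [pm ps po _] := ops.
have -> : L (p n.+1 * p n.+1) = L (p n.+1 * ('X * p n)).
  apply/eqP; rewrite -subr_eq0 -linearB -mulrBr; apply/eqP.
  apply: OPS_orthogonal_low ops _; apply: size_sub_monic => //.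
    by rewrite monicMl ?monicX.
  by rewrite mulrC size_mulX ?ps // monic_neq0.
have -> : p n.+1 * ('X * p n) = 'X * p n.+1 * p n by rewrite mulrCA mulrA.
rewrite pS // !mulrDl !linearD /= -!scalerAl !linearZ /=.
by rewrite (po n.+2) ?gtn_eqF // (po n.+1 n) ?gtn_eqF // mulr0 !add0r.
Qed.

(** The coefficients are quotients of values of [L] at real polynomials as soon as the [p n] are
    real, and the recurrence in turn makes the next [p n] real; the induction carries two
    consecutive polynomials. *)
Lemma recurrence_real (C : numClosedFieldType) (L : {scalar {poly C}})
    (p : nat -> {poly C}) (cs lam : nat -> C) :
  positive_definite L -> monic_OPS L p -> three_term_recurrence p cs lam ->
  forall n, cs n.+1 \is Num.real /\ 0 <= lam n.+2.
Proof.
move=> Lp ops rec; have [pm _ _ pn] := ops; have [p0 p1 pS] := rec.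
have sq n : p n \is a real_poly -> 0 < L (p n * p n).
  by move=> pr; rewrite positive_definite_sqr // monic_neq0.
have csE n : p n \is a real_poly -> cs n.+1 \is Num.real.
  move=> pr; have -> : cs n.+1 = L ('X * p n * p n) / L (p n * p n).
    by rewrite (recurrence_diag n ops rec) mulfK.
  rewrite rpredM ?rpredV //; apply: positive_definite_real => //.
    by rewrite !rpredM ?polyOverX.
  by rewrite rpredM.
have lamE n : p n \is a real_poly ->
    p n.+1 \is a real_poly -> 0 <= lam n.+2.
  move=> pr pr'; have -> : lam n.+2 = L (p n.+1 * p n.+1) / L (p n * p n).
    by rewrite (recurrence_offdiag n ops rec) mulfK.
  by rewrite divr_ge0 // ltW // sq.
have pr : forall n, p n \is a real_poly /\
    p n.+1 \is a real_poly.
  elim=> [|n [IH1 IH2]].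
    have p0r : p 0%N \is a real_poly by rewrite p0 rpred1.
    by split=> //; rewrite p1 rpredB ?polyOverX // polyOverC csE.
  split=> //; have -> : p n.+2 = 'X * p n.+1 - cs n.+2 *: p n.+1 - lam n.+2 *: p n.
    by rewrite pS //= addrAC !addrK.
  by rewrite !rpredB ?rpredM ?polyOverX ?polyOverZ ?csE ?ger0_real ?lamE.
by move=> n; have [? ?] := pr n; split; [exact: csE|exact: lamE].
Qed.

Lemma Geronimus_mulX (C : numClosedFieldType) (L Ls : {scalar {poly C}})
    (k : C) (p : {poly C}) :
  Geronimus_transformation L k Ls -> Ls ('X * p) = k * Ls p + L p.
Proof.
move=> LLs; rewrite -LLs mulrBl linearB /= mul_polyC linearZ /= addrC subrK.
by [].
Qed.

(** For [m < n], [L (P m * Ps n.+1) = Ls ((X - k) * P m * Ps n.+1) = 0] by degree, so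
    [Ps n.+1 - P n.+1] has a component along [P n] only. *)
Lemma Geronimus_two_terms (C : numClosedFieldType) (L Ls : {scalar {poly C}})
    (k : C) (P Ps : nat -> {poly C}) (n : nat) :
  Geronimus_transformation L k Ls -> monic_OPS L P -> monic_OPS Ls Ps ->
  Ps n.+1 = P n.+1 + (Ps n.+1 - P n.+1)`_n *: P n.
Proof.
move=> LLs opsP opsPs; have [pm ps po _] := opsP; have [pm' ps' _ _] := opsPs.
apply/eqP; rewrite -subr_eq0 opprD addrA subr_eq0; apply/eqP.
set D := Ps n.+1 - _; apply/eqP; rewrite -subr_eq0; apply/eqP.
have sD : (size D <= n.+1)%N by exact: size_sub_monic.
apply: (OPS_orthogonal_eq0 opsP (size_sub_lead (pm n) (ps n) sD)) => m mn.
rewrite mulrBr linearB /= -scalerAr linearZ /= po ?ltn_eqF // mulr0 subr0.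
rewrite /D mulrBr linearB /= po ?ltn_eqF ?leqW // subr0 -LLs mulrA mulrC.
apply: OPS_orthogonal_low opsPs _.
by rewrite size_monicM ?monicXsubC ?monic_neq0 // size_XsubC ps /= !addnS ltnS.
Qed.

(** When [Ls] is applied to the three-term recurrence, the inhomogeneous term [L (P n.+1)] vanishes
    by orthogonality to [P 0 = 1]. *)
Lemma Geronimus_moment_rec (C : numClosedFieldType) (L Ls : {scalar {poly C}})
    (k : C) (P : nat -> {poly C}) (cs lam : nat -> C) (n : nat) :
  Geronimus_transformation L k Ls -> monic_OPS L P ->
  three_term_recurrence P cs lam ->
  Ls (P n.+2) = (k - cs n.+2) * Ls (P n.+1) - lam n.+2 * Ls (P n).
Proof.
move=> LLs ops [P0 P1 PS]; have [_ _ po _] := ops.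
have LP : L (P n.+1) = 0 by rewrite -(mulr1 (P n.+1)) -P0 po.
have recE : k * Ls (P n.+1) =
    Ls (P n.+2) + cs n.+2 * Ls (P n.+1) + lam n.+2 * Ls (P n).
  have := Geronimus_mulX (P n.+1) LLs; rewrite LP addr0 => <-.
  by rewrite PS // !linearD !linearZ.
by rewrite mulrBl recE; ring.
Qed.

(* If [Ls (P (n + 1)) = 0] then [Ps (n + 1) = P (n + 1)], which is orthogonal to
   itself for [Ls]. *)
Lemma Geronimus_moment_neq0 (C : numClosedFieldType)
    (L Ls : {scalar {poly C}}) (k : C) (P Ps : nat -> {poly C}) (n : nat) :
  Geronimus_transformation L k Ls -> monic_OPS L P -> monic_OPS Ls Ps ->
  Ls (P n) != 0.
Proof.
move=> LLs opsP opsPs; have [pm ps po pn] := opsP.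
have [pm' ps' po' pn'] := opsPs; have Ps0 := OPS_0 opsPs.
elim: n => [|n IH].
  by have := pn' 0%N; rewrite Ps0 (OPS_0 opsP) mulr1.
have PsE := Geronimus_two_terms n LLs opsP opsPs.
have Ls0 : Ls (Ps n.+1) = 0 by rewrite -(mulr1 (Ps n.+1)) -Ps0 po'.
apply/eqP => T0; move: Ls0; rewrite PsE linearD linearZ /= T0 add0r => /eqP.
rewrite mulf_eq0 (negPf IH) orbF => /eqP al0.
have PsP : Ps n.+1 = P n.+1 by rewrite PsE al0 scale0r addr0.
have := pn' n.+1; apply/negP; rewrite negbK.
(* Splitting off the value at [k] from one factor gives [Ls (P n.+1 * P n.+1) = L (P n.+1 * q) + (P
   n.+1).[k] * Ls (P n.+1)], where both terms vanish. *)
have [q qE] : exists q, P n.+1 = ('X - k%:P) * q + (P n.+1).[k]%:P.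
  have /factor_theorem[q qE] : root (P n.+1 - (P n.+1).[k]%:P) k.
    by rewrite /root !hornerE subrr.
  by exists q; rewrite mulrC -qE subrK.
have sq : (size q <= n.+1)%N.
  have [->|q0] := eqVneq q 0; first by rewrite size_poly0.
  have : (size (('X - k%:P) * q)%R <= n.+2)%N.
    have -> : ('X - k%:P) * q = P n.+1 - (P n.+1).[k]%:P by rewrite {1}qE addrK.
    rewrite (leq_trans (size_polyD _ _)) // geq_max ps leqnn size_polyN.
    by rewrite (leq_trans (size_polyC_leq1 _)).
  by rewrite size_monicM ?monicXsubC // size_XsubC.
rewrite PsP {2}qE mulrDr linearD /=.
have -> : Ls (P n.+1 * (('X - k%:P) * q)) = 0.
  by rewrite mulrCA LLs (OPS_orthogonal_low opsP).
by rewrite [_ * _%:P]mulrC mul_polyC linearZ /= T0 mulr0 addr0.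
Qed.

(** The coefficient is forced by [Ls (Ps n.+1) = 0]. Dividing [P n - (P n).[k]] by [X - k] shows
    that [Ls (P n)] is [s_0^* P_n(k) + Q_n(k)], so this is the classical formula. *)
Lemma Geronimus_OPS (C : numClosedFieldType) (L Ls : {scalar {poly C}})
    (k : C) (P Ps : nat -> {poly C}) (n : nat) :
  Geronimus_transformation L k Ls -> monic_OPS L P -> monic_OPS Ls Ps ->
  Ps n.+1 = P n.+1 - (Ls (P n.+1) / Ls (P n)) *: P n.
Proof.
move=> LLs opsP opsPs; have [pm' ps' po' pn'] := opsPs.
have Ps0 := OPS_0 opsPs.
have := Geronimus_two_terms n LLs opsP opsPs; set al := _`_n => PsE.
have Ls0 : Ls (Ps n.+1) = 0 by rewrite -(mulr1 (Ps n.+1)) -Ps0 po'.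
have Tn := Geronimus_moment_neq0 n LLs opsP opsPs.
rewrite PsE -scaleNr; congr (_ + _ *: _).
move: Ls0; rewrite PsE linearD linearZ /= => /eqP; rewrite addrC addr_eq0 => /eqP.
by move=> alE; rewrite -mulNr -alE mulfK.
Qed.

(** * The branch of the square root *)

Lemma cnorm_leP (R : realType) (x M : Cplx R) :
  `|x| <= M -> cnorm x <= Re M.
Proof. by rewrite lecE => /andP[_]. Qed.

Lemma cnorm_lt (R : realType) (x : Cplx R) (e : R) :
  (`|x| < e%:C :> Cplx R) = (cnorm x < e).
Proof. by rewrite -ltcR. Qed.

Lemma pos_real_complex (R : realType) (e : Cplx R) :
  0 < e -> exists2 d : R, 0 < d & e = d%:C.
Proof.
move=> e0; have /complex_realP[d eE] : e \is Num.real by exact: gtr0_real.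
by exists d => //; move: e0; rewrite eE -ltcR.
Qed.

Lemma nonreal_Im (R : realType) (z : Cplx R) :
  (z \isn't Num.real) = (Im z != 0).
Proof. by case: z => p q; rewrite complex_real. Qed.

Lemma signed_Im_nonreal (R : realType) (s : R) (z : Cplx R) :
  0 < s * Im z -> z \isn't Num.real.
Proof.
by rewrite nonreal_Im; case: eqP => // ->; rewrite mulr0 ltxx.
Qed.

Lemma nonreal_sign (R : realType) (z : Cplx R) : z \isn't Num.real ->
  exists s : R, [/\ s = 1 \/ s = -1, s * s = 1 & s * Im z = `|Im z|].
Proof.
rewrite nonreal_Im => z0; exists (Num.sg (Im z)); split.
- by have [||//] := sgrP (Im z); [move=> zE; rewrite zE eqxx in z0|left|right].
- by rewrite -expr2 sqr_sg z0.
- by rewrite -normrEsg.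
Qed.

Lemma cnorm_real_dist (R : realType) (x y : R) :
  cnorm (x%:C - y%:C) = `|x - y|.
Proof. by rewrite -rmorphB; exact: cnorm_real. Qed.

Lemma cvg_real_part (R : realType) (u : nat -> Cplx R) (l : R) :
  (forall n, u n \is Num.real) -> u @ \oo --> (l%:C : Cplx R) ->
  (fun n => Re (u n)) @ \oo --> l.
Proof.
move=> ur /cvgrPdist_lt ul; apply/cvgrPdist_lt => e e0.
have e0C : 0 < (e%:C : Cplx R) by rewrite ltcR.
apply: filterS (ul _ e0C) => n; rewrite cnorm_lt -(RRe_real (ur n)).
by rewrite cnorm_real_dist.
Qed.

(** If [w z] were real, then [(z - c)^2 - 4 a] would be real, so [z - c] would be purely imaginary;
    but then this square would be negative. *)
Lemma sqrt_branch_Im_neq0 (R : realType) (a c : R) (w : Cplx R -> Cplx R)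
    (z : Cplx R) :
  0 <= a -> sqrt_branch (a%:C : Cplx R) c%:C w -> z \isn't Num.real ->
  Im (w z) != 0.
Proof.
move=> a0 [w2 _ _] zr; have := w2 z zr; move: zr; rewrite nonreal_Im.
case: (w z) => u v; case: z => p q /= q0.
rewrite !expr2 => /eqP; rewrite eq_complex /= => /andP[/eqP E1 /eqP E2].
apply/eqP => v0; have pc0 : (p - c) * q = 0 by move: E2; rewrite v0; lra.
move/eqP: pc0; rewrite mulf_eq0 (negPf q0) orbF => /eqP pc0.
have q20 : 0 < q * q by rewrite -expr2 exprn_even_gt0.
move: E1; rewrite v0 pc0; clear -q20 a0; nra.
Qed.

Lemma abs_Im_le (R : realType) (x : R[i]) : `|Im x| <= cnorm x.
Proof.
rewrite -(ger0_norm (cnorm_ge0 x)) -ler_sqr ?nnegrE // !real_normK ?num_real //.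
by rewrite sqr_cnorm lerDr sqr_ge0.
Qed.

Lemma normr_sign (R : realType) (s : R) : s * s = 1 -> `|s| = 1.
Proof. by rewrite -expr2 -sqrtr_sqr => ->; rewrite sqrtr1. Qed.

Lemma continuous_ray (R : realType) (s : R) (w : Cplx R -> Cplx R)
    (z : Cplx R) (t : R) :
  s * s = 1 -> {for (z + (0 +i* (s * t))%C : Cplx R), continuous w} ->
  {for t, continuous (fun t : R => s * Im (w (z + (0 +i* (s * t))%C)))}.
Proof.
move=> ss /cvgrPdist_lt wc; apply/cvgrPdist_lt => e e0.
have e0C : 0 < (e%:C : Cplx R) by rewrite ltcR.
have /nbhs_ballP[d /= /pos_real_complex[r r0 ->] dw] := wc _ e0C.
apply/nbhs_ballP; exists r => //= t' tt'.
have := dw (z + (0 +i* (s * t'))%C : Cplx R).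
rewrite /ball /= !cnorm_lt -mulrBr normrM (normr_sign ss) mul1r -ImN -ImD.
move=> H; apply: le_lt_trans (abs_Im_le _) (H _).
rewrite (_ : _ - _ = (0 +i* (s * (t - t')))%C); last first.
  by apply/eqP; rewrite eq_complex /=; apply/andP; split; apply/eqP;
    case: (z) => p q /=; ring.
rewrite /cnorm /= expr0n add0r sqrtr_sqr normrM (normr_sign ss) mul1r.
exact: tt'.
Qed.

(* [Im (w z)] has no zero off the real line, so on each half-plane it keeps
   the sign it has near infinity along a vertical ray. *)
Lemma sqrt_branch_Im (R : realType) (s a c : R) (w : Cplx R -> Cplx R)
    (z : Cplx R) :
  s * s = 1 -> 0 <= a -> sqrt_branch (a%:C : Cplx R) c%:C w ->
  0 < s * Im z -> 0 < s * Im (w z).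
Proof.
move=> ss a0 br z0; have [_ wd [B [M [Br wM]]]] := br.
pose ray t : Cplx R := z + (0 +i* (s * t))%C.
have rayI t : s * Im (ray t) = s * Im z + t.
  by rewrite /ray ImD /= mulrDr mulrA ss mul1r.
have ray0 t : 0 <= t -> 0 < s * Im (ray t) by move=> t0; rewrite rayI ltr_wpDr.
pose h t := s * Im (w (ray t)).
have hN0 t : 0 <= t -> h t != 0.
  move=> t0; rewrite mulf_neq0 //; last first.
    exact: (sqrt_branch_Im_neq0 a0 br (signed_Im_nonreal (ray0 t t0))).
  by apply/eqP => s0; move: ss; rewrite s0 mul0r => /eqP; rewrite eq_sym oner_eq0.
(* At height [T] the estimate on [w z - z] applies, and the signed imaginary part of [ray T] exceeds
   the bound [M]. *)
pose T := `|Re B| + `|Re M| + 1.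
have T0 : 0 <= T by rewrite !addr_ge0.
have hT : 0 < h T.
  have rT : s * Im (ray T) <= cnorm (ray T) by exact: signed_Im_le.
  have BT : B <= `|ray T|.
    rewrite -(RRe_real Br) -[`|_|]/((cnorm (ray T))%:C) lecR (le_trans _ rT) //.
    rewrite rayI /T; have := ler_norm (Re B).
    by have := normr_ge0 (Re M); lra.
  have := cnorm_leP (wM _ (signed_Im_nonreal (ray0 T T0)) BT).
  rewrite cnorm_dist => /(le_trans (signed_Im_le _ ss)).
  rewrite ImD ImN mulrDr mulrN rayI -/(h T); have := ler_norm (Re M).
  by have := normr_ge0 (Re B); rewrite /T; lra.
have ray_0 : ray 0 = z.
  by rewrite /ray mulr0; apply: addr0.
suff : 0 < h 0 by rewrite /h ray_0.
rewrite lt_neqAle eq_sym hN0 //= leNgt; apply/negP => h0.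
have [||t t0T ht] := @IVT R h 0 T 0 T0.
- apply: continuous_in_subspaceT => t; rewrite inE /= in_itv /= => /andP[t0 _].
  apply: continuous_ray ss _; apply: differentiable_continuous.
  by apply/derivable1_diffP; apply: wd; exact: signed_Im_nonreal (ray0 t t0).
- by rewrite ge_min le_max (ltW h0) (ltW hT) orbT.
by move: t0T; rewrite in_itv /= => /andP[t0 _]; have := hN0 t t0; rewrite ht eqxx.
Qed.

(** The root with [+ w z] is the attracting one because [w z] lies in the same half-plane as [z]. *)
Lemma sqrt_branch_fixed_points (R : realType) (s a c : R)
    (w : Cplx R -> Cplx R) (z : Cplx R) :
  s * s = 1 -> 0 <= a -> sqrt_branch (a%:C : Cplx R) c%:C w ->
  0 < s * Im z ->
  fixed_points s a c z ((z - c%:C + w z) / 2) ((z - c%:C - w z) / 2).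
Proof.
move=> ss a0 br z0; have wz := sqrt_branch_Im ss a0 br z0.
have [w2 _ _] := br; have {}w2 := w2 z (signed_Im_nonreal z0).
split=> //; first by field.
  have -> : (z - c%:C + w z) / 2 * ((z - c%:C - w z) / 2) =
    ((z - c%:C) ^+ 2 - w z ^+ 2) / 4 by field.
  by rewrite w2; field.
have -> : (z - c%:C + w z) / 2 = (2^-1)%:C * (z - c%:C + w z).
  by rewrite mulrC fmorphV rmorph_nat.
rewrite ImZ !ImD ImN /= subr0 mulrCA mulr_gt0 ?invr_gt0 //.
by rewrite mulrDr addr_gt0.
Qed.

Lemma compact_off_real_bounds (R : realType) (K : set (Cplx R))
    (k : Cplx R) :
  compact K -> (forall z, K z -> z \isn't Num.real /\ z != k) ->
  exists2 y : R, 0 < y &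
    forall z, K z -> [/\ y <= `|Im z|, y <= cnorm (z - k) & cnorm z <= y^-1].
Proof.
move=> /compact_near_coveringP cK Kk.
(* In this form every clause survives a decrease of [e], as compactness with [e] tending to [0] from
   the right requires. *)
pose good (e : R) (z : Cplx R) :=
  [/\ e <= `|Im z|, e <= cnorm (z - k) & e * cnorm z <= 1].
have : \forall e \near 0^'+, K `<=` good e.
  apply: cK => x Kx; have [xr xk] := Kk x Kx.
  (* Halving leaves room for [x] to move by [d]. *)
  pose d := Num.min `|Im x| (cnorm (x - k)) / 2.
  have d0 : 0 < d.
    rewrite divr_gt0 // lt_min normr_gt0 -nonreal_Im xr.
    by rewrite cnorm_gt0 subr_eq0.
  have dI : d * 2 <= `|Im x| by rewrite divfK // ge_min lexx.
  have dk : d * 2 <= cnorm (x - k) by rewrite divfK // ge_min lexx orbT.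
  have x1 : 0 < (cnorm x + d)^-1 by rewrite invr_gt0 ltr_wpDl // cnorm_ge0.
  have d0C : 0 < (d%:C : Cplx R) by rewrite ltcR.
  exists (ball x (d%:C : Cplx R),
    [set e : R | 0 < e /\ e <= d /\ e <= (cnorm x + d)^-1]).
    split=> /=; first by apply/nbhs_ballP; exists (d%:C : Cplx R).
    near=> e; split; first by near: e; exact: nbhs_right_gt.
    by split; near: e; exact: nbhs_right_le.
  move=> [x' e] /= [xx' [e0 [ed ex]]].
  have {}xx' : cnorm (x - x') <= d.
    by apply: ltW; move: xx'; rewrite /ball /= cnorm_lt.
  have Ix : `|Im x| <= `|Im x'| + d.
    have -> : Im x = Im x' + Im (x - x') by rewrite ImD ImN; ring.
    rewrite (le_trans (ler_normD _ _)) // lerD2l.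
    exact: le_trans (abs_Im_le _) xx'.
  have kx : cnorm (x - k) <= cnorm (x' - k) + d.
    have -> : x - k = (x' - k) + (x - x') by ring.
    by rewrite (le_trans (cnormD _ _)) // lerD2l.
  have x'x : cnorm x' <= cnorm x + d.
    have -> : x' = x - (x - x') by ring.
    by rewrite (le_trans (cnormB _ _)) // lerD2l.
  split; [lra|lra|]; rewrite -(@mulVf _ (cnorm x + d)); last first.
    by rewrite gt_eqF // -invr_gt0.
  by rewrite ler_pM ?cnorm_ge0 // ltW.
move=> Kgood; near (0 : R)^'+ => y.
have y0 : 0 < y by [].
exists y => // z Kz; have [yI yk yz] : good y z by apply: (near Kgood y).
by split=> //; rewrite -ler_pdivlMl // mulr1 in yz.
Unshelve. all: by end_near. Qed.

(** * Convergence of the ratios *)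

(** Non-vanishing and the half-plane bound are proved together: a ratio in the open half-plane is
    non-zero, so [P n.+1] does not vanish at [z] and the next ratio obeys the recursion. *)
Lemma OPS_ratio (R : realType) (s : R) (P : nat -> {poly Cplx R})
    (cs lam : nat -> Cplx R) (z : Cplx R) (r := fun n => (P n.+1).[z] / (P n).[z]) :
  three_term_recurrence P cs lam ->
  (forall n, cs n.+1 \is Num.real /\ 0 <= lam n.+2) -> 0 < s * Im z ->
  [/\ forall n, (P n).[z] != 0, s * Im z <= s * Im (r 0%N) &
    forall n, r n.+1 = z - (Re (cs n.+2))%:C - (Re (lam n.+2))%:C / r n].
Proof.
move=> [P0 P1 PS] real z0.
have r0 : s * Im z <= s * Im (r 0%N).
  rewrite /r P0 P1 !hornerE divr1 ImD ImN.
  have [c1 _] := real 0%N; have : Im (cs 1%N) = 0 by case: c1 => /complex_realP[k ->].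
  by move=> ->; rewrite subr0.
have csE n : (Re (cs n.+1))%:C = cs n.+1 by apply: RRe_real; case: (real n).
have lamE n : (Re (lam n.+2))%:C = lam n.+2.
  by apply: RRe_real; apply: ger0_real; case: (real n).
have lam0 n : 0 <= Re (lam n.+2).
  by case: (real n) => _; rewrite -lamE lecR.
have rS n : (P n.+1).[z] != 0 ->
    r n.+1 = z - (Re (cs n.+2))%:C - (Re (lam n.+2))%:C / r n.
  move=> Pn; have PE : (P n.+2).[z] =
      (z - cs n.+2) * (P n.+1).[z] - lam n.+2 * (P n).[z].
    have := congr1 (fun p : {poly Cplx R} => p.[z]) (PS n.+1 isT).
    by rewrite !hornerE => E; rewrite mulrBl E; ring.
  by rewrite csE lamE /r PE invf_div mulrBl mulfK // mulrA.
have H n : (P n).[z] != 0 /\ s * Im z <= s * Im (r n).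
  elim: n => [|n [Pn rn]]; first by rewrite P0 hornerE oner_eq0.
  have Pn1 : (P n.+1).[z] != 0.
    have : r n != 0 by apply: (@signed_Im_neq0 _ s); exact: lt_le_trans rn.
    by rewrite /r mulf_eq0 negb_or => /andP[].
  split=> //; rewrite rS //; apply: Im_ratio_step => //.
  exact: le_trans (ltW z0) rn.
by split=> // n; [case: (H n)|apply: rS; case: (H n.+1)].
Qed.

Lemma Geronimus_ratio_uniform (R : realType) (L Ls : {scalar {poly Cplx R}})
    (P Ps : nat -> {poly Cplx R}) (k : Cplx R) (a c : R)
    (w : Cplx R -> Cplx R) (K : set (Cplx R)) :
  positive_definite L -> monic_OPS L P -> k \isn't Num.real ->
  Geronimus_transformation L k Ls -> monic_OPS Ls Ps -> 0 <= a ->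
  Nevai_class (a%:C : Cplx R) c%:C P -> sqrt_branch (a%:C : Cplx R) c%:C w ->
  compact K -> (forall z, K z -> z \isn't Num.real /\ z != k) ->
  forall e : R, 0 < e -> exists N, forall n, (N <= n)%N -> forall z, K z ->
  (Ps n.-1).[z] != 0 /\
  cnorm ((Ps n).[z] / (Ps n.-1).[z] - (z - c%:C + w z) / 2) <= e.
Proof.
move=> Lp opsP kr LLs opsPs a0 [cs [lam [rec csc lama]]] br cK Kk e e0.
have real := recurrence_real Lp opsP rec.
pose C n := Re (cs n.+2); pose La n := Re (lam n.+2).
have shift2 (u : nat -> Cplx R) (l : Cplx R) :
    u @ \oo --> l -> (fun n => u n.+2) @ \oo --> l.
  move=> ul; rewrite (_ : (fun n => _) = [sequence u (n + 2)%N]_n).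
    by rewrite cvg_shiftn.
  by apply/funext => n /=; rewrite addn2.
have Cc : C @ \oo --> c.
  by apply: cvg_real_part (shift2 _ _ csc) => n; case: (real n.+1).
have Laa : La @ \oo --> a.
  apply: cvg_real_part (shift2 _ _ lama) => n; apply: ger0_real.
  by case: (real n).
have La0 n : 0 <= La n.
  have [_ l0] := real n; move: (l0).
  by rewrite -(RRe_real (ger0_real l0)) lecR.
have [y y0 Ky] := compact_off_real_bounds cK Kk.
pose B := y^-1 + `|c| + a / y.
have B0 : 0 < B.
  by rewrite !ltr_pwDl ?invr_gt0 // divr_ge0 // ltW.
have [sk [_ skk kE]] := nonreal_sign kr.
have k0 : 0 < sk * Im k by rewrite kE normr_gt0 -nonreal_Im.
have fpk := sqrt_branch_fixed_points skk a0 br k0.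
have T0 n : Ls (P n) != 0 by exact: Geronimus_moment_neq0 LLs opsP opsPs.
pose x n := Ls (P n.+1) / Ls (P n).
have x0 n : x n != 0 by rewrite mulf_neq0 ?invr_eq0.
have xS n : x n.+1 = k - (C n)%:C - (La n)%:C / x n.
  have [cr l0] : cs n.+2 \is Num.real /\ 0 <= lam n.+2.
    by split; [case: (real n.+1)|case: (real n)].
  rewrite /C /La (RRe_real cr) (RRe_real (ger0_real l0)) /x.
  rewrite (Geronimus_moment_rec n LLs opsP rec) invf_div.
  by rewrite mulrBl mulfK // mulrA.
have [t [t' [tD tM xt]]] :=
  ratio_limit_dichotomy skk a0 Cc Laa La0 fpk x0 xS.
(* This is the separation bound for [|f - t|], with [y] bounding both [s * Im z] and [|z - k|] from
   below on [K]. *)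
pose D := y * y / (B + cnorm t').
have D0 : 0 < D.
  by rewrite divr_gt0 ?mulr_gt0 // ltr_pwDl // cnorm_ge0.
pose A := 1 + (B + 1) * (8 / D).
have A0 : 0 < A.
  by apply: addr_gt0 => //; apply: mulr_gt0; [exact: addr_gt0|exact: divr_gt0].
pose e' := Num.min (Num.min 1 (D / 4)) (e / A).
have e'0 : 0 < e' by rewrite /e' !lt_min ltr01 (divr_gt0 D0) ?(divr_gt0 e0).
have e'1 : e' <= 1 by rewrite /e' !ge_min lexx.
have e'D : e' <= D / 4 by rewrite /e' !ge_min lexx !orbT.
have e'A : e' * A <= e by rewrite -ler_pdivlMr // /e' !ge_min lexx !orbT.
have N1N1 : -1 * -1 = 1 :> R by rewrite mulrNN mulr1.
(* The set [K] may meet both half-planes, and each sign has its own threshold. *)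
have [N1 HN1] := @ratio_limit R 1 a c y B C La (mulr1 1) a0 y0 B0 Cc Laa La0 e' e'0.
have [N2 HN2] := @ratio_limit R (-1) a c y B C La N1N1 a0 y0 B0 Cc Laa La0 e' e'0.
have [N3 HN3] := xt e' e'0.
(* With the index written [n.+2], both [Ps n.+2] and [Ps n.+1] have positive index and factor
   through [r - x]. *)
exists (N1 + N2 + N3).+2 => -[//|[//|n]]; rewrite !ltnS => Nn z Kz.
have [yI yk zy] := Ky z Kz; have [zr _] := Kk z Kz.
have [s [sE ss zE]] := nonreal_sign zr.
have z0 : 0 < s * Im z by rewrite zE (lt_le_trans y0).
have fp := sqrt_branch_fixed_points ss a0 br z0.
have yz : y <= s * Im z by rewrite zE.
have [_ _ fz] := fixed_points_norm ss a0 fp y0 yz.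
set f := (z - c%:C + w z) / 2 in fp fz *; set g := (z - c%:C - w z) / 2 in fp.
have fB : cnorm f <= B.
  by rewrite (le_trans fz) // /B !lerD2r.
have [Pz r0 rS] := OPS_ratio rec real z0.
pose r m := (P m.+1).[z] / (P m).[z].
have rf m : (N1 + N2 + N3 <= m)%N -> cnorm (r m - f) <= e'.
  move=> Nm; case: sE => sE; rewrite sE in yz r0 fp.
    apply: (HN1 z f g) => //.
    by rewrite (leq_trans _ Nm) // -addnA leq_addr.
  apply: (HN2 z f g) => //.
  by rewrite (leq_trans _ Nm) // addnAC leq_addl.
have N3n : (N3 <= n)%N by rewrite (leq_trans _ Nn) // leq_addl.
have sep := fixed_points_separation ss skk a0 fp fpk tD tM y0 yz (ltW y0) yk
  fB (lexx _).
have [rx est] := quotient_perturbation D0 e'0 e'1 e'D sep fB (rf n Nn)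
  (rf n.+1 (leqW Nn)) (HN3 n N3n) (HN3 n.+1 (leqW N3n)).
have PsE m : (Ps m.+1).[z] = (P m).[z] * (r m - x m).
  rewrite (Geronimus_OPS m LLs opsP opsPs) !hornerE mulrBr.
  by rewrite (mulrC _ (r m)) (mulrC _ (x m)) divfK.
rewrite /= !PsE; split; first by rewrite mulf_neq0.
have -> : (P n.+1).[z] * (r n.+1 - x n.+1) / ((P n).[z] * (r n - x n)) =
    r n * (r n.+1 - x n.+1) / (r n - x n).
  by rewrite {3}/r; field; rewrite rx Pz.
exact: le_trans est e'A.
Qed.

Theorem theorem4p9 (R : realType) (L Ls : {scalar {poly Cplx R}})
    (P Ps : nat -> {poly Cplx R}) (kappa a c : Cplx R)
    (w : Cplx R -> Cplx R) :
  positive_definite L ->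
  monic_OPS L P ->
  kappa \isn't Num.real ->
  Geronimus_transformation L kappa Ls ->
  monic_OPS Ls Ps ->
  0 <= a ->
  c \is Num.real ->
  Nevai_class a c P ->
  sqrt_branch a c w ->
  forall K : set (Cplx R),
    compact K ->
    (forall z, K z -> z \isn't Num.real /\ z != kappa) ->
    (\forall n \near \oo, forall z, K z -> (Ps n.-1).[z] != 0) /\
    {uniform K, (fun n z => (Ps n).[z] / (Ps n.-1).[z]) @ \oo -->
                (fun z => (z - c + w z) / 2)}.
Proof.
move=> Lp opsP kr LLs opsPs a0 cr nev br K cK Kk.
have [a' aE] : exists a', a = a'%:C by apply/complex_realP; exact: ger0_real.
have [c' cE] : exists c', c = c'%:C by exact/complex_realP.
subst a c; have {}a0 : 0 <= a' by rewrite -lecR.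
have unif := Geronimus_ratio_uniform Lp opsP kr LLs opsPs a0 nev br cK Kk.
split.
  by have [N HN] := unif 1 ltr01; exists N => // n /= Nn z /(HN n Nn)[].
move=> U /uniform_nbhs[E [+ EU]]; rewrite -entourage_ballE => -[d /= d0 dE].
have [d' d'0 dd'] := pos_real_complex d0.
(* Balls are open, hence half the radius. *)
have [|N HN] := unif (d' / 2); first by rewrite divr_gt0.
exists N => // n /= Nn; apply: EU => z Kz /=; apply: dE.
rewrite /ball /= dd' cnorm_lt cnorm_dist.
have [_ /le_lt_trans] := HN n Nn z Kz; apply.
by rewrite ltr_pdivrMr // ltr_pMr // ltr1n.
Qed.
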